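(* Fix a grid time $t\le T-\delta t$, let $u_{t:(T-\delta t)}=(u_t,u_{t+\delta t},\dots,u_{T-\delta t})^T\in\mathbb R^k$ (with $k=(T-t)/\delta t\le n$), and let $C_t(u_t,\dots,u_{T-\delta t})$ be the certainty-equivalent cost from time $t$ defined in the context. For grid times $s\le r$ put $\pi^\kappa_{s:r}=\prod_{\theta=s}^{r}(1-\kappa_\theta\delta t)$. For each grid time $\tau$ with $t\le\tau\le T$ let $$L_\tau=\begin{pmatrix} \pi^\kappa_{(t+\delta t):(\tau-\delta t)}v_t\mu_t\delta t & \pi^\kappa_{(t+2\delta t):(\tau-\delta t)}v_{t+\delta t}\mu_{t+\delta t}\delta t & \cdots & v_{\tau-\delta t}\mu_{\tau-\delta t}\delta t & 0 & 0 & \cdots \\ -a_t\delta t & -a_{t+\delta t}\delta t & \cdots & -a_{\tau-\delta t}\delta t & 0 & 0 & \cdots \\ 0 & 0 & \cdots & 0 & 1 & 0 & \cdots \end{pmatrix}\in\mathbb R^{3\times k}$$ (columns indexed by $t,t+\delta t,\dots,T-\delta t$; the entry $1$ is in the column of index $\tau$ when $\tau<T$), and $$Y_\tau=\begin{pmatrix} \pi^\kappa_{t:(\tau-\delta t)}p_t+\sum_{\theta=t}^{\tau-\delta t}\pi^\kappa_{\theta:(\tau-\delta t)}\alpha_\theta\delta t \\ q_t \\ 0 \end{pmatrix}.$$ Then we have the representation $$C_t(u_t,u_{t+\delta t},\dots,u_{T-\delta t})=u_{t:(T-\delta t)}^T\mathbf A_tu_{t:(T-\delta t)}+\mathbf b_t^Tu_{t:(T-\delta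 t)}+\mathbf c_t,$$ where $$\mathbf A_t=\Big\{\sum_{\tau=t}^{T-\delta t}L_\tau^TM_\tau L_\tau\Big\}\delta t+L_T^TM_TL_T,$$ $$\mathbf b_t^T=\Big\{\sum_{\tau=t}^{T-\delta t}\big(2Y_\tau^TM_\tau L_\tau+N_\tau^TL_\tau\big)\Big\}\delta t+2Y_T^TM_TL_T+N_T^TL_T,$$ $\mathbf c_t$ is a constant term, and where for $\tau<T$ $$M_\tau=\begin{pmatrix} 0 & 0 & a_\tau/2 \\ 0 & \beta_\tau & 0 \\ a_\tau/2 & 0 & a_\tau\eta_\tau \end{pmatrix},\qquad N_\tau=\begin{pmatrix} 0 \\ 0 \\ a_\tau s_\tau \end{pmatrix},$$ and at time $T$ $$M_T=\begin{pmatrix} 0 & 0 & 0 \\ 0 & \tilde\beta_T & 0 \\ 0 & 0 & 0 \end{pmatrix},\qquad N_T=\begin{pmatrix} 0 \\ 0 \\ 0 \end{pmatrix}.$$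
   Context: Time grid: $0,\delta t,\dots,n\delta t=T$; all sums and products over time run over the grid (empty sums are $0$, empty products are $1$). Parameters (deterministic): $Q_0$ (initial quantity), $v_t$ (expected market volume rate), $a_t=v_t/Q_0$, $\eta_t$ (temporary impact), $\mu_t$ (permanent impact), $w_t=(Q_0\mu_t,-1)^T$, $s_t$ (half-spread), $\kappa_t$ (mean-reversion), $\alpha_t$ (trend), $\beta_t$ (urgency), $\tilde\beta_T$ (terminal penalty). Certainty-equivalent (noise-free) dynamics: starting from the given $X_t=(p_t,q_t)^T$ ($p_t$ price slippage, $q_t$ proportion of non-executed shares), the state $X_\tau=(p_\tau,q_\tau)^T$ evolves for $\tau=t,\dots,T-\delta t$ by $$X_{\tau+\delta t}=\begin{pmatrix} 1-\kappa_\tau\delta t & 0 \\ 0 & 1 \end{pmatrix}X_\tau+a_\tau u_\tau w_\tau\delta t+\alpha_\tau e_1\delta t,\qquad e_1=(1,0)^T.$$ Certainty-equivalent cost: $$C_t(u_t,\dots,u_{T-\delta t})=\sum_{\tau=t}^{T-\delta t}\big\{a_\tau\eta_\tau u_\tau^2+a_\tau(p_\tau+s_\tau)u_\tau+\beta_\tau q_\tau^2\big\}\delta t+\tilde\beta_Tq_T^2 .$$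
   Formalization: In Y_τ the trend term α_θδt is weighted by π^κ over (θ+δt):(τ−δt) instead of the printed θ:(τ−δt); as printed the representation fails, e.g. two steps with κ_0=1/2, α_0=1, δt=Q_0=v=1, all else 0, gives C=u_{δt} but b^Tu=u_{δt}/2. *)

(* Defs.v *)
From mathcomp Require Import all_boot all_order all_algebra.

Set Implicit Arguments.
Unset Strict Implicit.
Unset Printing Implicit Defensive.

Import GRing.Theory Num.Theory.
Local Open Scope ring_scope.

(* The grid time i * dt is represented by its index i; the horizon T is the
   index [nsteps].  Coefficients indexed by time are only ever read at indices
   below [nsteps]. *)
Record market (R : realFieldType) := Market {
  nsteps : nat;
  dt     : R;
  Q0     : R;          (* initial quantity *)
  vol    : nat -> R;   (* expected market volume rate, v *)
  eta    : nat -> R;   (* temporary impact *)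
  mu     : nat -> R;   (* permanent impact *)
  spread : nat -> R;   (* half-spread, s *)
  kappa  : nat -> R;   (* mean reversion *)
  alpha  : nat -> R;   (* trend *)
  beta   : nat -> R;   (* urgency *)
  betaT  : R           (* terminal penalty *)
}.

Section Model.

Variables (R : realFieldType) (P : market R).

Local Notation n := (nsteps P).
Local Notation dt := (dt P).

Definition rate (i : nat) : R := vol P i / Q0 P.

Definition mx_of_rows (m k : nat) (rows : seq (seq R)) : 'M[R]_(m, k) :=
  \matrix_(i < m, j < k) (nth [::] rows i)`_j.

Definition vec2 (x y : R) : 'cV[R]_2 := mx_of_rows 2 1 [:: [:: x]; [:: y]].
Definition vec3 (x y z : R) : 'cV[R]_3 :=
  mx_of_rows 3 1 [:: [:: x]; [:: y]; [:: z]].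

Definition price (X : 'cV[R]_2) : R := X 0 0.
Definition quantity (X : 'cV[R]_2) : R := X 1 0.

Definition impact (i : nat) : 'cV[R]_2 := vec2 (Q0 P * mu P i) (-1).

Definition step (i : nat) (X : 'cV[R]_2) (ui : R) : 'cV[R]_2 :=
  mx_of_rows 2 2 [:: [:: 1 - kappa P i * dt; 0]; [:: 0; 1]] *m X
  + (rate i * ui * dt) *: impact i + (alpha P i * dt) *: vec2 1 0.

Fixpoint state_after (t : nat) (X : 'cV[R]_2) (u : nat -> R) (m : nat) :
    'cV[R]_2 :=
  if m is j.+1 then step (t + j) (state_after t X u j) (u (t + j)%N) else X.

(* State at grid index i >= t, started from X at index t. *)
Definition state (t : nat) (X : 'cV[R]_2) (u : nat -> R) (i : nat) :
    'cV[R]_2 :=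
  state_after t X u (i - t).

(* Only the controls u t, ..., u (n - 1) enter the cost. *)
Definition cost (t : nat) (X : 'cV[R]_2) (u : nat -> R) : R :=
  \sum_(t <= i < n)
     (rate i * eta P i * u i ^+ 2
      + rate i * (price (state t X u i) + spread P i) * u i
      + beta P i * quantity (state t X u i) ^+ 2) * dt
  + betaT P * quantity (state t X u n) ^+ 2.

Definition controls (t : nat) (u : nat -> R) : 'cV[R]_(n - t) :=
  \col_(j < n - t) u (t + j)%N.

(* Half-open product over s <= th < r, that is, over the grid times from s to
   r - dt inclusive; an inclusive upper index r - 1 would be wrong at r = 0
   because of truncated subtraction. *)
Definition pik (s r : nat) : R := \prod_(s <= th < r) (1 - kappa P th * dt).

Definition L (t i : nat) : 'M[R]_(3, n - t) :=
  \matrix_(r < 3, j < n - t)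
    (let th := (t + j)%N in
     [:: (if (th < i)%N then pik th.+1 i * vol P th * mu P th * dt else 0);
         (if (th < i)%N then - rate th * dt else 0);
         (if th == i then 1 else 0)]`_r).

(* The trend term alpha_th * dt enters the price at time th + dt, so its decay
   factor up to time i runs over the grid times from th + dt on. *)
Definition Y (t : nat) (p q : R) (i : nat) : 'cV[R]_3 :=
  vec3 (pik t i * p + \sum_(t <= th < i) pik th.+1 i * alpha P th * dt) q 0.

Definition M (i : nat) : 'M[R]_3 :=
  mx_of_rows 3 3
    [:: [:: 0;            0;        rate i / 2];
        [:: 0;            beta P i; 0];
        [:: rate i / 2;   0;        rate i * eta P i]].

Definition MT : 'M[R]_3 :=
  mx_of_rows 3 3 [:: [:: 0; 0; 0]; [:: 0; betaT P; 0]; [:: 0; 0; 0]].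

Definition N (i : nat) : 'cV[R]_3 := vec3 0 0 (rate i * spread P i).

Definition NT : 'cV[R]_3 := vec3 0 0 0.

Definition A (t : nat) : 'M[R]_(n - t) :=
  dt *: (\sum_(t <= i < n) ((L t i)^T *m M i *m L t i))
  + (L t n)^T *m MT *m L t n.

(* The row vector b_t^T: here T is transposition, whereas in betaT, MT and NT
   it is the horizon. *)
Definition bT (t : nat) (p q : R) : 'rV[R]_(n - t) :=
  dt *: (\sum_(t <= i < n)
           (2 *: ((Y t p q i)^T *m M i *m L t i) + (N i)^T *m L t i))
  + 2 *: ((Y t p q n)^T *m MT *m L t n) + NT^T *m L t n.

End Model.

(* Main.v *)
(** The state at time [i] is affine in the controls: the vector with entries
    price, quantity and control at time [i] equals [L u + Y].  Each running
    cost is a quadratic polynomial [Z^T M Z + N^T Z] in that vector with [M]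
    symmetric, so substituting [Z = L u + Y] and summing gives the
    representation. *)
Require Import Defs.
From mathcomp Require Import all_boot all_order all_algebra.
From mathcomp Require Import ring.

Import GRing.Theory Num.Theory.
Local Open Scope ring_scope.

(** The two cross terms of the expansion are [1 x 1] matrices and, as [S] is symmetric, transposes
    of each other; hence they are equal, which gives the factor [2]. *)
Lemma quadratic_affine (R : comNzRingType) (m k : nat) (S : 'M[R]_m)
    (D : 'M[R]_(m, k)) (y b : 'cV[R]_m) (u : 'cV[R]_k) :
  S^T = S ->
  (D *m u + y)^T *m S *m (D *m u + y) + b^T *m (D *m u + y) =
  u^T *m (D^T *m S *m D) *m u
  + (2 *: (y^T *m S *m D) + b^T *m D) *m u
  + (y^T *m S *m y + b^T *m y).
Proof.
move=> symS.
have cross : (D *m u)^T *m S *m y = y^T *m S *m D *m u.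
  rewrite [LHS]mx11_scalar -tr_scalar_mx -mx11_scalar.
  by rewrite !trmx_mul !trmxK symS !mulmxA.
rewrite [(_ + _)^T]linearD /= !mulmxDl !mulmxDr.
rewrite cross trmx_mul -scalemxAl scaler_nat mulr2n.
rewrite !mulmxA -!addrA; congr (_ + _).
rewrite !addrA; congr (_ + _).
by rewrite -!addrA; congr (_ + (_ + _)); rewrite addrC.
Qed.

Lemma tr_M (R : realFieldType) (P : market R) (i : nat) : (M P i)^T = M P i.
Proof. by apply/matrixP => -[[|[|[|//]]] ?] [[|[|[|//]]] ?]; rewrite !mxE. Qed.

Lemma tr_MT (R : realFieldType) (P : market R) : (MT P)^T = MT P.
Proof. by apply/matrixP => -[[|[|[|//]]] ?] [[|[|[|//]]] ?]; rewrite !mxE. Qed.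

Lemma running_costE (R : realFieldType) (P : market R) (i : nat) (x y z : R) :
  ((vec3 x y z)^T *m M P i *m vec3 x y z + (N P i)^T *m vec3 x y z) 0 0 =
  rate P i * eta P i * z ^+ 2 + rate P i * (x + spread P i) * z
  + beta P i * y ^+ 2.
Proof. by rewrite !(mxE, big_ord_recl, big_ord0) /=; field. Qed.

Lemma terminal_costE (R : realFieldType) (P : market R) (x y z : R) :
  ((vec3 x y z)^T *m MT P *m vec3 x y z + (NT R)^T *m vec3 x y z) 0 0 =
  betaT P * y ^+ 2.
Proof. by rewrite !(mxE, big_ord_recl, big_ord0) /=; ring. Qed.

Lemma pik_recr (R : realFieldType) (P : market R) (s r : nat) :
  (s <= r)%N -> pik P s r.+1 = pik P s r * (1 - kappa P r * dt P).
Proof. by move=> le_sr; rewrite /pik big_nat_recr. Qed.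

(** The factor [Q0] in [impact] cancels the denominator of [rate], which leaves [vol] alone; this
    requires [Q0] to be nonzero. *)
Lemma price_step (R : realFieldType) (P : market R) (i : nat)
    (X : 'cV[R]_2) (x : R) :
  Q0 P != 0 ->
  price (step P i X x) =
  (1 - kappa P i * dt P) * price X
  + (vol P i * mu P i * x + alpha P i) * dt P.
Proof.
move=> Q0_neq0; rewrite /price /step !(mxE, big_ord_recl, big_ord0) /= /rate.
have -> : lift 0 0 = 1 :> 'I_2 by apply/val_inj.
by field.
Qed.

Lemma quantity_step (R : realFieldType) (P : market R) (i : nat)
    (X : 'cV[R]_2) (x : R) :
  quantity (step P i X x) = quantity X - rate P i * x * dt P.
Proof.
rewrite /quantity /step !(mxE, big_ord_recl, big_ord0) /=.
have -> : lift 0 0 = 1 :> 'I_2 by apply/val_inj.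
by ring.
Qed.

(** Variation of constants for the linear price recursion: an input at time [th] first reaches the
    price at [th.+1], so its decay factor starts there. *)
Lemma price_state_after (R : realFieldType) (P : market R) (t m : nat)
    (X : 'cV[R]_2) (u : nat -> R) :
  Q0 P != 0 ->
  price (state_after P t X u m) =
  pik P t (t + m) * price X
  + \sum_(t <= th < t + m)
      pik P th.+1 (t + m) * (vol P th * mu P th * u th + alpha P th) * dt P.
Proof.
move=> Q0_neq0; elim: m => [|m IHm].
  by rewrite addn0 /pik !big_geq // mul1r addr0.
rewrite /= price_step // IHm addnS pik_recr ?leq_addr //.
rewrite big_nat_recr ?leq_addr //= addrA mulrDr.
(* The newest input has not decayed yet: its factor is an empty product. *)
have -> : pik P (t + m).+1 (t + m).+1 = 1 by rewrite /pik big_geq.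
rewrite mul1r.
congr (_ + _ + _); first by ring.
rewrite mulr_sumr; apply: eq_big_nat => th /andP[_ lt_th].
by rewrite pik_recr //; ring.
Qed.

Lemma quantity_state_after (R : realFieldType) (P : market R) (t m : nat)
    (X : 'cV[R]_2) (u : nat -> R) :
  quantity (state_after P t X u m) =
  quantity X - \sum_(t <= th < t + m) rate P th * u th * dt P.
Proof.
elim: m => [|m IHm]; first by rewrite addn0 big_geq ?subr0.
by rewrite /= quantity_step IHm addnS big_nat_recr ?leq_addr //= opprD addrA.
Qed.

(** Passes from columns, indexed by offsets [j], to grid times [t + j]; [F] is row [r] of [B] as a
    function of absolute time. *)
Lemma col_controls (R : realFieldType) (P : market R) (t : nat)
    (u : nat -> R) (B : 'M[R]_(3, nsteps P - t)) (F : nat -> R) (r : 'I_3) :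
  (forall j, B r j = F (t + j)%N) ->
  (B *m controls P t u) r 0 = \sum_(t <= th < nsteps P) F th * u th.
Proof.
move=> BF; rewrite mxE -[t in RHS]add0n big_addn big_mkord.
by apply: eq_bigr => j _; rewrite BF !mxE addnC.
Qed.

Lemma sum_before (V : nmodType) (t i n : nat) (F : nat -> V) :
  (i <= n)%N ->
  \sum_(t <= th < n) (if (th < i)%N then F th else 0) = \sum_(t <= th < i) F th.
Proof.
move=> le_in; rewrite -big_mkcond (big_nat_widen _ _ _ _ _ le_in) /=.
by apply: eq_bigl => th.
Qed.

(** No column of [L] belongs to the horizon, so the third entry is [0] there. *)
Lemma affine_state (R : realFieldType) (P : market R) (t i : nat) (p q : R)
    (u : nat -> R) :
  Q0 P != 0 -> (t <= i <= nsteps P)%N ->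
  L P t i *m controls P t u + Y P t p q i =
  vec3 (price (state P t (vec2 p q) u i)) (quantity (state P t (vec2 p q) u i))
       (if (i < nsteps P)%N then u i else 0).
Proof.
move=> Q0_neq0 /andP[le_ti le_in].
rewrite /state price_state_after // quantity_state_after subnKC //.
apply/matrixP => r c; rewrite !ord1 {c} mxE.
pose F th := [:: (if (th < i)%N then
                    pik P th.+1 i * vol P th * mu P th * dt P else 0);
                 (if (th < i)%N then - rate P th * dt P else 0);
                 (if th == i then 1 else 0)]`_r.
rewrite (@col_controls _ _ _ _ _ F); last by move=> j; rewrite mxE.
rewrite {}/F !mxE; case: r => [[|[|[|//]]] lt_r3] /=.
- under eq_bigr do rewrite (fun_if ( *%R^~ (u _))) mul0r.
  rewrite sum_before // /price mxE /= addrCA -big_split /=; congr (_ + _).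
  by apply: eq_bigr => th _; ring.
- under eq_bigr do rewrite (fun_if ( *%R^~ (u _))) mul0r.
  rewrite sum_before // /quantity mxE /= addrC -sumrN; congr (_ + _).
  by apply: eq_bigr => th _; ring.
- under eq_bigr do rewrite (fun_if ( *%R^~ (u _))) mul0r mul1r.
  (* The third row is an indicator: the sum picks out [u i] if [i] is below the horizon and is [0]
     otherwise. *)
  by rewrite -big_mkcond addr0 /= big_nat1_eq le_ti.
Qed.

Theorem theorem3 (R : realFieldType) (P : market R)
    (dt_gt0 : 0 < dt P) (Q0_neq0 : Q0 P != 0)
    (t : nat) (t_lt_T : (t < nsteps P)%N) (p q : R) :
  exists c : R, forall u : nat -> R,
    cost P t (vec2 p q) u =
      ((controls P t u)^T *m A P t *m controls P t u) 0 0
      + (bT P t p q *m controls P t u) 0 0 + c.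
Proof.
pose n := nsteps P; pose y := Y P t p q.
(* The constant is the value of the quadratic expressions at zero controls, where [L u + Y] reduces
   to [Y]. *)
exists ((dt P *: (\sum_(t <= i < n)
                    ((y i)^T *m M P i *m y i + (N P i)^T *m y i))
         + ((y n)^T *m MT P *m y n + (NT R)^T *m y n)) 0 0) => u.
set w := controls P t u; pose Z i := L P t i *m w + y i.
pose X i := state P t (vec2 p q) u i.
have ZE i : (t <= i <= n)%N ->
    Z i = vec3 (price (X i)) (quantity (X i)) (if (i < n)%N then u i else 0).
  exact: affine_state.
have costZ : cost P t (vec2 p q) u =
    (dt P *: (\sum_(t <= i < n) ((Z i)^T *m M P i *m Z i + (N P i)^T *m Z i))
     + ((Z n)^T *m MT P *m Z n + (NT R)^T *m Z n)) 0 0.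
  (* [terminal_costE] holds for any third entry, so the value [0] at the horizon does no harm. *)
  rewrite mxE (ZE n) ?leqnn ?andbT ?(ltnW t_lt_T) // terminal_costE.
  rewrite /cost; congr (_ + _).
  rewrite mxE summxE mulr_sumr; apply: eq_big_nat => i /andP[le_ti lt_in].
  have lt_iT : (t <= i <= n)%N by rewrite le_ti ltnW.
  by rewrite (ZE i lt_iT) lt_in running_costE mulrC.
rewrite {}costZ.
under eq_big_nat do rewrite quadratic_affine ?tr_M //.
rewrite quadratic_affine ?tr_MT // 2!big_split /=.
rewrite -mulmx_suml -mulmx_sumr -mulmx_suml 2!scalerDr.
(* Running and terminal terms are paired by degree in the controls: quadratic, linear, constant. *)
rewrite addrACA [X in X + _]addrACA.
have addE (S1 S2 : 'M[R]_1) : S1 0 0 + S2 0 0 = (S1 + S2) 0 0 by rewrite mxE.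
rewrite !addE /A /bT mulmxDr !mulmxDl -scalemxAr -!scalemxAl.
by rewrite !addrA.
Qed.
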